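(* Let $A=\mathrm{diag}(a_1,\dots,a_n)$ with $a_i>0$ and let $\epsilon=\sigma/(\sigma\pm\rho)$. Consider the reduced system of the rubber Chaplygin ball rolling over a sphere with the inertia operator $\mathbb I(E_i\wedge E_j)=(a_ia_j-D)E_i\wedge E_j$, i.e. the system $$\dot\gamma=\frac{\epsilon^2}{(\gamma,A\gamma)}\big(A^{-1}p-(p,A^{-1}\gamma)\gamma\big),$$ $$\dot p=\frac{\epsilon(1-\epsilon)}{(\gamma,A\gamma)^2}\big((A^{-1}p,p)A\gamma+(p,A^{-1}\gamma)(A\gamma,\gamma)p\big)-\frac{\epsilon}{(\gamma,A\gamma)}(p,A^{-1}p)\gamma$$ on $T^*S^{n-1}=\{(p,\gamma)\in\mathbb R^{2n}\mid(\gamma,\gamma)=1,\ (\gamma,p)=0\}$. Under the time substitution $d\tau=\epsilon(A\gamma,\gamma)^{\frac1{2\epsilon}-1}dt$ and the change of momenta $p\mapsto\tilde p=\epsilon(A\gamma,\gamma)^{\frac1{2\epsilon}-1}p$, this system becomes a Hamiltonian system (with respect to the canonical symplectic form in the variables $(\tilde p,\gamma)$) describing the geodesic flow on $S^{n-1}$ of the metric $$ds^2_{A,\epsilon}=(\gamma,A\gamma)^{\frac1\epsilon-2}\big((A\,d\gamma,d\gamma)(A\gamma,\gamma)-(A\gamma,d\gamma)^2\big).$$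
   Context: Vectors of $\mathbb R^n$ are columns, $(x,y)=x^Ty$, $x\wedge y=xy^T-yx^T$; $E_1,\dots,E_n$ is the standard basis of $\mathbb R^n$; $d\gamma=(d\gamma_1,\dots,d\gamma_n)^T$. $\rho>0$ is the radius and $m>0$ the mass of the rolling ball, $D=m\rho^2$, and $\sigma>0$ is the radius of the fixed sphere (sign $+$ for rolling over the outer surface; sign $-$, with $\sigma\neq\rho$, for rolling over the inner surface or for a shell rolling around the fixed sphere in its interior); so $\epsilon$ is a nonzero real constant. The new momenta: with $\nu(\gamma)=\epsilon(A\gamma,\gamma)^{\frac1{2\epsilon}-1}$, $d\tau=\nu\,dt$ and $\gamma'=d\gamma/d\tau=\dot\gamma/\nu$, the reduced Lagrangian $L_{red}(\dot\gamma,\gamma)=\frac1{2\epsilon^2}\big((A\dot\gamma,\dot\gamma)(A\gamma,\gamma)-(A\gamma,\dot\gamma)^2\big)$ becomes $L^*(\gamma',\gamma)=L_{red}(\nu\gamma',\gamma)$, and $\tilde p=\partial L^*/\partial\gamma'=\nu p$. The cotangent bundle in the new variables is $\{(\tilde p,\gamma)\in\mathbb R^{2n}\mid(\gamma,\gamma)=1,\ (\tilde p,\gamma)=0\}$ with the symplectic form $\tilde{\mathbf w}=d\tilde p_1\wedge d\gamma_1+\dots+d\tilde p_n\wedge d\gamma_n$ restricted to it. The geodesic flow of a metric is the Hamiltonian flow of its kinetic energy, here the Legendre transform of $\frac12ds^2_{A,\epsilon}(\gamma',\gamma')$. *)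

(* Defs.v *)
From HB Require Import structures.
From mathcomp Require Import all_boot all_order all_algebra.
From mathcomp Require Import all_classical all_reals all_analysis.
Set Implicit Arguments.
Unset Strict Implicit.
Unset Printing Implicit Defensive.
Import Order.TTheory GRing.Theory Num.Theory.
Import numFieldNormedType.Exports.
Local Open Scope classical_set_scope.
Local Open Scope ring_scope.

Section Geometry.
Context {R : realType} {n : nat}.
Implicit Types (x y v gamma : 'cV[R]_n) (z X Y : 'cV[R]_n * 'cV[R]_n).

Definition dot x y : R := (x^T *m y) 0 0.

Definition wedge x y : 'M[R]_n := x *m y^T - y *m x^T.

Definition basis_vec (i : 'I_n) : 'cV[R]_n := delta_mx i 0.

Definition sphere : set 'cV[R]_n := [set gamma | dot gamma gamma = 1].

Definition tangent_sphere gamma : set 'cV[R]_n := [set v | dot gamma v = 0].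

(* Points of the phase space are ordered (momentum, position). *)
Definition cotangent_sphere : set ('cV[R]_n * 'cV[R]_n) :=
  [set z | dot z.2 z.2 = 1 /\ dot z.2 z.1 = 0].

(* Kernel of the differentials of the two constraint functions at z. *)
Definition tangent_cotangent z : set ('cV[R]_n * 'cV[R]_n) :=
  [set X | dot z.2 X.2 = 0 /\ dot X.2 z.1 + dot z.2 X.1 = 0].

(* dp_1 /\ dgamma_1 + ... + dp_n /\ dgamma_n *)
Definition canonical_form X Y : R := dot X.1 Y.2 - dot X.2 Y.1.

(* X is the Hamiltonian vector at z of the restriction of H to the cotangent
   bundle, for the restricted form.  The sign is the one for which the
   unconstrained equations are gamma' = dH/dp, p' = - dH/dgamma.  Only
   the derivatives of H along the bundle matter, so the result does not depend
   on how H is extended to the ambient space. *)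
Definition hamiltonian_vector (H : 'cV[R]_n * 'cV[R]_n -> R) z X : Prop :=
  [/\ differentiable H z, tangent_cotangent z X
    & forall Y, tangent_cotangent z Y -> canonical_form X Y = - 'd H z Y].

Definition hamiltonian_motion (H : 'cV[R]_n * 'cV[R]_n -> R) (K : set R)
    (q : R -> 'cV[R]_n * 'cV[R]_n) : Prop :=
  forall s, K s -> cotangent_sphere (q s) /\
    exists X, is_derive s 1 q X /\ hamiltonian_vector H (q s) X.

Definition grad (f : 'cV[R]_n -> R) v : 'cV[R]_n :=
  \col_i 'D_(basis_vec i) f v.

(* H is, on the cotangent bundle of the sphere, the Legendre transform of the
   Lagrangian L v gamma: every covector p at gamma is dL/dv at exactly one
   tangent velocity v, and H(p, gamma) = (p, v) - L(v, gamma) for that v. *)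
Definition legendre_transform (L : 'cV[R]_n -> 'cV[R]_n -> R)
    (H : 'cV[R]_n * 'cV[R]_n -> R) : Prop :=
  forall p gamma, cotangent_sphere (p, gamma) ->
    exists v,
      unique (fun u => tangent_sphere gamma u /\
                       p = grad (fun w => L w gamma) u) v /\
      H (p, gamma) = dot p v - L v gamma.

End Geometry.

Section Ball.
Context {R : realType} {n : nat}.
Variables (A : 'M[R]_n) (eps : R).
Implicit Types (p v gamma : 'cV[R]_n) (z : 'cV[R]_n * 'cV[R]_n).

Definition reduced_gamma_dot p gamma : 'cV[R]_n :=
  (eps ^+ 2 / dot gamma (A *m gamma)) *:
    (invmx A *m p - dot p (invmx A *m gamma) *: gamma).

Definition reduced_p_dot p gamma : 'cV[R]_n :=
  (eps * (1 - eps) / dot gamma (A *m gamma) ^+ 2) *: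
    (dot (invmx A *m p) p *: (A *m gamma)
     + (dot p (invmx A *m gamma) * dot (A *m gamma) gamma) *: p)
  - (eps / dot gamma (A *m gamma) * dot p (invmx A *m p)) *: gamma.

Definition reduced_motion (J : set R) (z : R -> 'cV[R]_n * 'cV[R]_n) : Prop :=
  forall t, J t -> cotangent_sphere (z t) /\
    is_derive t 1 z
      (reduced_p_dot (z t).1 (z t).2, reduced_gamma_dot (z t).1 (z t).2).

Definition nu gamma : R :=
  eps * dot (A *m gamma) gamma `^ (1 / (2 * eps) - 1).

Definition new_momenta z : 'cV[R]_n * 'cV[R]_n := (nu z.2 *: z.1, z.2).

(* The quadratic form of the metric at gamma, on the velocity v. *)
Definition ds2 gamma v : R :=
  dot gamma (A *m gamma) `^ (1 / eps - 2) *
  (dot (A *m v) v * dot (A *m gamma) gamma - dot (A *m gamma) v ^+ 2).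

End Ball.

(* Radius sigma of the fixed sphere, radius rho of the ball; inner selects the
   sign -. *)
Definition radii_ratio {R : realType} (inner : bool) (sigma rho : R) : R :=
  if inner then sigma / (sigma - rho) else sigma / (sigma + rho).

(* Main.v *)
Require Import Defs.
From HB Require Import structures.
From mathcomp Require Import all_boot all_order all_algebra.
From mathcomp Require Import all_classical all_reals all_analysis.
From mathcomp Require Import ring lra.
Import Order.TTheory GRing.Theory Num.Theory.
Import numFieldNormedType.Exports.
Local Open Scope classical_set_scope.
Local Open Scope ring_scope.
Set Implicit Arguments.
Unset Strict Implicit.
Unset Printing Implicit Defensive.

(* In the momenta the kinetic energy of the metric is
   H(p, gamma) = 1/2 (A gamma, gamma)^(1 - 1/eps) (A^-1 p, p).  The
   symplectic form is nondegenerate on the tangent spaces of the cotangent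
   bundle, so the Hamiltonian vector field G of H is unique, and it can be
   written down explicitly.  If F is the reduced field and Phi the change of
   momenta, then dPhi(F) = nu * G o Phi: this is an algebraic identity, since
   nu^2 = eps^2 (A gamma, gamma)^(1/eps - 2).  As nu does not vanish, tau is
   locally invertible, and the chain rule carries motions of F to motions of G
   and back. *)

Lemma gt0_powRD {R : realType} (x r s : R) :
  0 < x -> x `^ (r + s) = x `^ r * x `^ s.
Proof. by move=> x0; rewrite powRD// (gt_eqF x0) implybT. Qed.

(** * Algebra of the Euclidean inner product *)

Section Dot.
Context {R : realType} {n : nat}.
Implicit Types (x y z : 'cV[R]_n).

Lemma dotE x y : dot x y = \sum_i x i 0 * y i 0.
Proof. by rewrite /dot mxE; apply: eq_bigr => i _; rewrite mxE. Qed.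

Lemma dotC x y : dot x y = dot y x.
Proof. by rewrite !dotE; apply: eq_bigr => i _; rewrite mulrC. Qed.

Lemma dotDl x y z : dot (x + y) z = dot x z + dot y z.
Proof. by rewrite /dot linearD mulmxDl mxE. Qed.

Lemma dotDr x y z : dot z (x + y) = dot z x + dot z y.
Proof. by rewrite dotC dotDl !(dotC z). Qed.

Lemma dotZl c x y : dot (c *: x) y = c * dot x y.
Proof. by rewrite /dot linearZ -scalemxAl mxE. Qed.

Lemma dotZr c x y : dot y (c *: x) = c * dot y x.
Proof. by rewrite dotC dotZl (dotC y). Qed.

Lemma dotNl x y : dot (- x) y = - dot x y.
Proof. by rewrite -scaleN1r dotZl mulN1r. Qed.

Lemma dotNr x y : dot y (- x) = - dot y x.
Proof. by rewrite dotC dotNl (dotC y). Qed.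

Lemma dot0l x : dot 0 x = 0.
Proof. by rewrite -(scale0r x) dotZl mul0r. Qed.

Lemma dot_eq0 x : dot x x = 0 -> x = 0.
Proof.
move=> /eqP; rewrite dotE psumr_eq0 => [/allP x0|i _]; last exact: sqr_ge0.
apply/colP => i; rewrite mxE; apply/eqP.
by have /implyP/(_ isT) := x0 i (mem_index_enum i); rewrite mulf_eq0 orbb.
Qed.

Lemma dot_sym_mx (S : 'M[R]_n) x y : S^T = S -> dot (S *m x) y = dot x (S *m y).
Proof. by move=> Ssym; rewrite /dot trmx_mul Ssym mulmxA. Qed.

End Dot.

Definition dot_linear {R : realType} {n : nat} :=
  (@dotDl R n, @dotDr R n, @dotZl R n, @dotZr R n, @dotNl R n, @dotNr R n).

(** * Differential calculus for products, matrices and powers *)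

Lemma scaler_is_bilinear {R : realType} {W : normedModType R} :
  bilinear_for
    (GRing.Scale.Law.clone _ _ *:%R _) (GRing.Scale.Law.clone _ _ *:%R _)
    (@GRing.scale R W : R -> W -> W).
Proof.
split=> [u'|u] a x y /=.
- by rewrite scalerDl scalerA.
- by rewrite scalerDr !scalerA mulrC.
Qed.

HB.instance Definition _ (R : realType) (W : normedModType R) :=
  bilinear_isBilinear.Build R R W W _ _ (@GRing.scale R W : R -> W -> W)
    (@scaler_is_bilinear R W).

(** Bridge between derivatives of curves and Fréchet differentials, so that product and chain rules
    are proved only once, for [is_diff]. *)
Lemma is_derive_diffP {R : realType} {W : normedModType R} (f : R -> W) (t : R) (df : W) :
  is_derive t 1 f df <-> is_diff t f (fun h => h *: df).
Proof.
split=> [[fd fdf]|[fd fdf]].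
  apply: DiffDef; first exact/derivable1_diffP.
  by rewrite deriv1E// derive1E fdf.
apply: DeriveDef; first exact/derivable1_diffP.
by rewrite deriveE// fdf scale1r.
Qed.

Section Differentials.
Context {R : realType} {V : normedModType R}.

Lemma is_diff_sum (W : normedModType R) (I : finType) (f df : I -> V -> W) x :
  (forall i, is_diff x (f i) (df i)) ->
  is_diff x (fun y => \sum_i f i y) (fun h => \sum_i df i h).
Proof.
move=> fdf.
have -> : (fun y => \sum_i f i y) = \sum_i f i.
  by apply/funext => y; rewrite fct_sumE.
have -> : (fun y => \sum_i df i y) = \sum_i df i.
  by apply/funext => y; rewrite fct_sumE.
elim/big_ind2 : _ => [|g dg g' dg' gdg gdg'|i _]; last exact: fdf.
- exact: is_diff_cst.
- exact: is_diffD.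
Qed.

(** Scaling is a continuous bilinear map on [R * W], so its differential is the Leibniz formula;
    composing with the pair [(k, f)] gives the product rule. *)
Lemma is_diff_scale (W : normedModType R) (k dk : V -> R) (f df : V -> W) x :
  is_diff x k dk -> is_diff x f df ->
  is_diff x (fun y => k y *: f y) (fun h => k x *: df h + dk h *: f x).
Proof.
move=> kdk fdf.
have sc : continuous (fun p : R * W => p.1 *: p.2) by move=> p; exact: scale_continuous.
have dsc : differentiable (fun p : R * W => p.1 *: p.2) (k x, f x).
  exact: (@differentiable_bilin _ _ _ _ (@GRing.scale R W)).
have : is_diff (k x, f x) (fun p : R * W => p.1 *: p.2)
    (fun q => k x *: q.2 + q.1 *: f x).
  by apply: DiffDef => //; exact: (@diff_bilin _ _ _ _ (@GRing.scale R W)).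
move=> D.
exact: (@is_diff_comp _ _ _ _ (fun y => (k y, f y)) _ (fun p : R * W => p.1 *: p.2)).
Qed.

Lemma is_diff_scalec (W : normedModType R) (k : R) (f df : V -> W) x :
  is_diff x f df -> is_diff x (fun y => k *: f y) (fun h => k *: df h).
Proof. exact: is_diffZ. Qed.

Lemma is_diff_mx_coord m n (f df : V -> 'M[R]_(m, n)) x i j :
  is_diff x f df -> is_diff x (fun y => f y i j) (fun h => df h i j).
Proof.
move=> fdf.
pose c := fun N : 'M[R]_(m, n) => N i j : R.
have lc : linear c by move=> a M N; rewrite /c !mxE.
(* Packing the coordinate as a linear map lets [diff_lin] identify it with its own differential. *)
pose cL := GRing.isLinear.Build _ _ _ _ _ lc.
pose cl : {linear 'M[R]_(m, n) -> R} := HB.pack c cL.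
have ccl : continuous cl.
  by move=> M; apply: differentiable_continuous; exact: differentiable_coord.
have : is_diff (f x) c c.
  by apply: DiffDef; [exact: differentiable_coord|exact: (diff_lin _ ccl)].
move=> ?.
exact: (@is_diff_comp _ _ _ _ f df c c).
Qed.

Lemma is_diff_dot n (f df g dg : V -> 'cV[R]_n) x :
  is_diff x f df -> is_diff x g dg ->
  is_diff x (fun y => dot (f y) (g y)) (fun h => dot (f x) (dg h) + dot (df h) (g x)).
Proof.
move=> fdf gdg; rewrite (_ : (fun y => dot (f y) (g y)) = fun y => \sum_i f y i 0 *: g y i 0); last first.
  by apply/funext => y; rewrite dotE.
apply: (@is_diff_eq _ _ _ _ (fun h => \sum_i (f x i 0 *: dg h i 0 + df h i 0 *: g x i 0))).
- apply: is_diff_sum => i.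
  by apply: is_diff_scale; exact: is_diff_mx_coord.
- by apply/funext => h; rewrite !dotE -big_split.
Qed.

Lemma is_diff_mulmx m n (M : 'M[R]_(m, n)) (f df : V -> 'cV[R]_n) x :
  is_diff x f df -> is_diff x (fun y => M *m f y) (fun h => M *m df h).
Proof.
(* As a combination of the constant columns of [M], the product falls under the sum and scaling
   rules. *)
have ME y : M *m y = \sum_j y j 0 *: col j M.
  apply/colP => i; rewrite mxE summxE; apply: eq_bigr => j _.
  by rewrite !mxE mulrC.
move=> fdf; rewrite (_ : (fun y => M *m f y) = fun y => \sum_j f y j 0 *: col j M); last first.
  by apply/funext => y; rewrite ME.
apply: (@is_diff_eq _ _ _ _ (fun h => \sum_j (f x j 0 *: 0 + df h j 0 *: col j M))).
  apply: is_diff_sum => i.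
  by apply: is_diff_scale; exact: is_diff_mx_coord.
by apply/funext => h; rewrite ME; apply: eq_bigr => j _; rewrite scaler0 add0r.
Qed.

Lemma is_diff_powR (f df : V -> R) x (r : R) :
  0 < f x -> is_diff x f df ->
  is_diff x (fun y => f y `^ r) (fun h => r * f x `^ (r - 1) * df h).
Proof.
move=> fx fdf.
have D : is_diff (f x) (fun y : R => y `^ r) (fun h : R => h *: (r * f x `^ (r - 1))).
  by apply/is_derive_diffP; exact: is_derive1_powR.
apply: (@is_diff_eq _ _ _ _ (fun h => df h *: (r * f x `^ (r - 1)))).
- exact: (@is_diff_comp _ _ _ _ f df (fun y : R => y `^ r)).
- by apply/funext => h; rewrite /GRing.scale /= mulrC.
Qed.

Lemma is_diff_fst (U W : normedModType R) (f df : V -> U * W) x :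
  is_diff x f df -> is_diff x (fun y => (f y).1) (fun h => (df h).1).
Proof.
move=> fdf; have cf : continuous (@fst U W) by move=> p; exact: cvg_fst.
have : is_diff (f x) fst fst.
  by apply: DiffDef; [exact: linear_differentiable|exact: diff_lin].
by move=> ?; exact: (@is_diff_comp _ _ _ _ f df fst fst).
Qed.

Lemma is_diff_snd (U W : normedModType R) (f df : V -> U * W) x :
  is_diff x f df -> is_diff x (fun y => (f y).2) (fun h => (df h).2).
Proof.
move=> fdf; have cf : continuous (@snd U W) by move=> p; exact: cvg_snd.
have : is_diff (f x) snd snd.
  by apply: DiffDef; [exact: linear_differentiable|exact: diff_lin].
by move=> ?; exact: (@is_diff_comp _ _ _ _ f df snd snd).
Qed.

End Differentials.

Lemma grad_eq {R : realType} {n : nat} (f : 'cV[R]_n -> R) (v w : 'cV[R]_n) :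
  is_diff v f (dot w) -> grad f v = w.
Proof.
move=> fw; apply/colP => i; rewrite mxE deriveE; last exact: ex_diff.
rewrite diff_val dotE (bigD1 i)//= big1 => [|j ji].
  by rewrite mxE !eqxx mulr1 addr0.
by rewrite mxE (negbTE ji) mulr0.
Qed.

(** * The metric, its kinetic energy and the explicit Hamiltonian field *)

Section GeodesicFlow.
Context {R : realType} {n : nat}.
Variables (A : 'M[R]_n) (eps : R).
Hypothesis symA : A^T = A.
Hypothesis posA : forall v : 'cV[R]_n, v != 0 -> 0 < dot (A *m v) v.
Hypothesis unitA : A \in unitmx.
Implicit Types (p v gamma : 'cV[R]_n) (z X Y : 'cV[R]_n * 'cV[R]_n).

Let symB : (invmx A)^T = invmx A.
Proof. by rewrite trmx_inv symA. Qed.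

Lemma sphere_gt0 gamma : dot gamma gamma = 1 -> 0 < dot (A *m gamma) gamma.
Proof.
move=> g1; apply: posA; apply/eqP => g0; move: g1; rewrite g0 dot0l.
by move=> /esym/eqP; rewrite oner_eq0.
Qed.

(* Matrix of ds2 up to a conformal factor; gamma spans its kernel. *)
Definition metric_mx gamma : 'M[R]_n :=
  dot (A *m gamma) gamma *: A - (A *m gamma) *m (A *m gamma)^T.

Lemma metric_mxE gamma v :
  metric_mx gamma *m v =
  dot (A *m gamma) gamma *: (A *m v) - dot (A *m gamma) v *: (A *m gamma).
Proof.
rewrite mulmxBl -scalemxAl; congr (_ - _).
by rewrite -(mulmxA (A *m gamma)) (mx11_scalar (_^T *m v)) mul_mx_scalar.
Qed.

Lemma metric_mx_sym gamma : (metric_mx gamma)^T = metric_mx gamma.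
Proof. by rewrite linearB linearZ/= trmx_mul trmxK symA. Qed.

Lemma ds2E gamma v :
  ds2 A eps gamma v =
  dot (A *m gamma) gamma `^ (1 / eps - 2) * dot (metric_mx gamma *m v) v.
Proof.
rewrite /ds2 metric_mxE !dot_linear (dotC gamma); congr (_ * _); ring.
Qed.

Lemma ds2_gt0 gamma v : sphere gamma -> tangent_sphere gamma v ->
  v != 0 -> 0 < ds2 A eps gamma v.
Proof.
rewrite /sphere /tangent_sphere /= => g1 gv v0.
have al0 := sphere_gt0 g1.
rewrite ds2E mulr_gt0 ?powR_gt0// metric_mxE.
set al := dot (A *m gamma) gamma in al0 *; set c := dot (A *m gamma) v.
(* (A w, w) = al * (al * (A v, v) - c ^ 2), so no Cauchy-Schwarz is needed. *)
pose w := al *: v - c *: gamma.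
have w0 : w != 0.
  (* Since [v] is orthogonal to the unit vector [gamma], pairing [w = 0] with [gamma] forces
     [c = 0], and then [al *: v = 0]. *)
  apply/eqP => w0; have : dot gamma w = 0 by rewrite w0 dotC dot0l.
  rewrite /w !dot_linear gv g1 => cE.
  have c0 : c = 0 by lra.
  move: w0; rewrite /w c0 scale0r subr0 => /eqP.
  by rewrite scaler_eq0 gt_eqF//= (negbTE v0).
have := posA w0.
rewrite /w mulmxBr -!scalemxAr !dot_linear -/c -/al.
rewrite (dot_sym_mx v gamma symA) (dotC v) -/c => cs.
by rewrite -(pmulr_rgt0 _ al0); lra.
Qed.

Definition geodesic_ham z : R :=
  2^-1 * (dot (A *m z.2) z.2 `^ (1 - 1 / eps) * dot (invmx A *m z.1) z.1).

Lemma is_diff_geodesic_ham z : 0 < dot (A *m z.2) z.2 ->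
  is_diff z geodesic_ham (fun Y =>
    dot (A *m z.2) z.2 `^ (1 - 1 / eps) * dot (invmx A *m z.1) Y.1 +
    (1 - 1 / eps) * dot (A *m z.2) z.2 `^ (- (1 / eps)) *
      dot (invmx A *m z.1) z.1 * dot (A *m z.2) Y.2).
Proof.
move=> al0.
have D1 : is_diff z (fun y : 'cV[R]_n * 'cV[R]_n => y.1) (fun h => h.1).
  by apply: is_diff_fst; exact: is_diff_id.
have D2 : is_diff z (fun y : 'cV[R]_n * 'cV[R]_n => y.2) (fun h => h.2).
  by apply: is_diff_snd; exact: is_diff_id.
have Dal := is_diff_dot (is_diff_mulmx A D2) D2.
have Dh := is_diff_dot (is_diff_mulmx (invmx A) D1) D1.
have Dp := is_diff_powR (x := z) (f := fun y => dot (A *m y.2) y.2) (1 - 1 / eps) al0 Dal.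
have D := is_diff_scalec 2^-1 (is_diff_scale Dp Dh).
apply: (is_diff_eq D); apply/funext => Y /=.
rewrite (dot_sym_mx Y.2 _ symA) (dot_sym_mx Y.1 _ symB) !(dotC Y.1) !(dotC Y.2).
have -> : 1 - 1 / eps - 1 = - (1 / eps) by ring.
set k := 1 - 1 / eps; rewrite /GRing.scale /=.
by field.
Qed.

(** Hamilton's equations of [geodesic_ham] with two Lagrange multipliers: a multiple of [z.2] in the
    velocity, mirrored by a multiple of [z.1] in the force, and a multiple of [z.2] in the force.
    Tangency to the constraint [dot z.2 z.2 = 1] fixes the first multiplier, and tangency to
    [dot z.2 z.1 = 0] fixes the second. *)
Definition geodesic_field z : 'cV[R]_n * 'cV[R]_n :=
  let al := dot (A *m z.2) z.2 in
  let be := dot z.1 (invmx A *m z.2) in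
  let h := dot (invmx A *m z.1) z.1 in
  ((al `^ (1 - 1 / eps) * be) *: z.1
   - ((1 - 1 / eps) * al `^ (- (1 / eps)) * h) *: (A *m z.2)
   - (1 / eps * al `^ (1 - 1 / eps) * h) *: z.2,
   al `^ (1 - 1 / eps) *: (invmx A *m z.1 - be *: z.2)).

(** Two test vectors suffice. Pairing with [(X2, 0)] gives [X2 = 0]; then [X1] is itself orthogonal
    to [g], and it may serve as a position component once the momentum component is corrected along
    [g] to stay tangent. *)
Lemma canonical_form_nondegenerate z X :
  cotangent_sphere z -> tangent_cotangent z X ->
  (forall Y, tangent_cotangent z Y -> canonical_form X Y = 0) -> X = 0.
Proof.
case: z X => p g [X1 X2]; rewrite /cotangent_sphere /tangent_cotangent /= => -[gg gp].
move=> [gX2 X2p] H.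
have X20 : X2 = 0.
  apply: dot_eq0; have /= := H (X2, 0).
  by rewrite dotC dot0l gX2 dot0l addr0 /canonical_form /= (dotC X1) dot0l sub0r
    => /(_ (conj erefl erefl))/eqP; rewrite oppr_eq0 => /eqP.
subst X2; rewrite dot0l add0r in X2p.
congr pair; apply: dot_eq0; have /= := H (- dot X1 p *: g, X1).
rewrite /canonical_form /= dot0l subr0; apply; split => //.
by rewrite !dot_linear gg mulr1 subrr.
Qed.

Lemma hamiltonian_vector_geodesicP z X : cotangent_sphere z ->
  hamiltonian_vector geodesic_ham z X <-> X = geodesic_field z.
Proof.
move=> cz; have [gg gp] := cz; have al0 := sphere_gt0 gg.
have D := is_diff_geodesic_ham al0.
have Ggeq : tangent_cotangent z (geodesic_field z).
  rewrite /tangent_cotangent /geodesic_field /= !dot_linear.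
  rewrite gg gp (dotC z.1) (dot_sym_mx z.2 _ symB) (dotC z.2 (A *m _)).
  set al := dot (A *m z.2) z.2 in al0 *.
  (* The force along [A *m z.2] contributes an extra factor [al] when paired with [z.2]; this puts
     all terms over one power. *)
  have -> : al `^ (1 - 1 / eps) = al * al `^ (- (1 / eps)).
    by rewrite gt0_powRD// powRr1// ltW.
  by split; ring.
have Gham Y : tangent_cotangent z Y ->
    canonical_form (geodesic_field z) Y = - 'd geodesic_ham z Y.
  move=> [gY2 Y2p]; rewrite diff_val /canonical_form /geodesic_field /= !dot_linear gY2.
  (* Tangency of [Y] makes the two terms of the first multiplier cancel each other. *)
  have -> : dot z.1 Y.2 = - dot z.2 Y.1 by rewrite (dotC z.1); lra.
  ring.
split=> [[_ tX HX]|->]; last by split => //; exact: ex_diff.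
move: (geodesic_field z) Ggeq Gham => G Ggeq Gham.
apply/eqP; rewrite -subr_eq0; apply/eqP.
apply: (canonical_form_nondegenerate cz).
  case: tX Ggeq => x1 x2 [y1 y2]; split.
    by rewrite /= !dot_linear x1 y1 subrr.
  by rewrite /= !dot_linear; lra.
move=> Y tY; have := HX Y tY; rewrite -(Gham Y tY) /canonical_form /= !dot_linear.
lra.
Qed.

(** The fibre derivative is the linear map [c *: metric_mx g]. It is inverted explicitly on the
    tangent space, and positivity of the metric there gives uniqueness. *)
Lemma legendre_geodesic_ham :
  legendre_transform (fun v gamma => 2^-1 * ds2 A eps gamma v) geodesic_ham.
Proof.
move=> p g [/= gg gp]; have al0 := sphere_gt0 gg.
set al := dot (A *m g) g in al0.
pose c := al `^ (1 / eps - 2).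
have c0 : 0 < c by exact: powR_gt0.
have gradE u : grad (fun w => 2^-1 * ds2 A eps g w) u = c *: (metric_mx g *m u).
  apply: grad_eq; under eq_fun do rewrite ds2E -/al -/c.
  have D := is_diff_dot (is_diff_mulmx (metric_mx g) (is_diff_id u)) (is_diff_id u).
  have D' := is_diff_scalec 2^-1 (is_diff_scalec c D).
  apply: (is_diff_eq D'); apply/funext => h /=.
  rewrite (dot_sym_mx h _ (metric_mx_sym g)) (dotC h) dotZl /GRing.scale /=.
  by field.
pose be := dot p (invmx A *m g).
(* [metric_mx g] sends [invmx A *m p] to [al *: p], because [p] is orthogonal to [g], and it kills
   [g]; the multiple of [g] is subtracted to make [v] tangent. *)
pose v := (c * al)^-1 *: (invmx A *m p - be *: g).
have AB x : A *m (invmx A *m x) = x by rewrite mulmxA mulmxV// mul1mx.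
have Av : metric_mx g *m v = c^-1 *: p.
  rewrite metric_mxE /v -!scalemxAr mulmxBr AB -scalemxAr !dot_linear -/al.
  rewrite (dot_sym_mx g _ symA) AB gp.
  apply/colP => i; rewrite !mxE; field.
  by rewrite !gt_eqF.
have pBg : dot g (invmx A *m p) = be by rewrite /be -(dot_sym_mx _ _ symB) dotC.
exists v; split; first split.
- split; first by rewrite /tangent_sphere /= /v !dot_linear pBg gg mulr1 subrr mulr0.
  by rewrite gradE Av scalerA divff ?scale1r// gt_eqF.
- move=> u [/= gu pu].
  have gv : dot g v = 0 by rewrite /v !dot_linear pBg gg mulr1 subrr mulr0.
  apply/eqP; rewrite -subr_eq0; apply: contraT => w0.
  (* Both velocities have the same image under [metric_mx g], so the metric would vanish on their
     nonzero tangent difference. *)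
  have : 0 < ds2 A eps g (v - u).
    apply: ds2_gt0 => //; by rewrite /tangent_sphere /= dotDr dotNr gv gu subrr.
  rewrite ds2E mulmxBr Av.
  rewrite gradE in pu; rewrite {1}pu scalerA mulVf ?gt_eqF// scale1r subrr.
  by rewrite dot0l mulr0 ltxx.
- rewrite ds2E Av /geodesic_ham /= -/al -/c dotZl.
  rewrite (mulrA c) divff ?gt_eqF// mul1r.
  (* The metric at [v] equals [dot p v], so the energy is half of it; the factor [(c * al)^-1] in
     [v] is exactly the power of [al] in the Hamiltonian. *)
  suff -> : dot p v = al `^ (1 - 1 / eps) * dot (invmx A *m p) p.
    by rewrite !div1r; field.
  rewrite /v !dot_linear (dotC p g) gp mulr0 subr0 (dotC p); congr (_ * _).
  rewrite /c -{2}(powRr1 (ltW al0)) -gt0_powRD// -powRN.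
  by congr (_ `^ _); ring.
Qed.

End GeodesicFlow.

(** * Chain rules along curves and change of time *)

Lemma is_derive_comp {R : realType} {V : normedModType R} (f : R -> V)
    (g : R -> R) (t dg : R) (df : V) :
  is_derive t 1 g dg -> is_derive (g t) 1 f df ->
  is_derive t 1 (fun s => f (g s)) (dg *: df).
Proof.
move=> /is_derive_diffP Dg /is_derive_diffP Df.
apply/is_derive_diffP.
have D := @is_diff_comp _ _ _ _ g _ f _ t Dg Df.
by apply: (is_diff_eq D); apply/funext => h /=; rewrite scalerA.
Qed.

Lemma is_derive_diff_comp {R : realType} {V W : normedModType R} (F dF : V -> W)
    (f : R -> V) (t : R) (df : V) :
  is_derive t 1 f df -> is_diff (f t) F dF ->
  is_derive t 1 (fun s => F (f s)) (dF df).
Proof.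
move=> /is_derive_diffP Df DF.
apply/is_derive_diffP.
have D := @is_diff_comp _ _ _ _ f _ F _ t Df DF.
apply: (is_diff_eq D); apply/funext => h /=.
by rewrite -(@diff_val _ _ _ _ _ _ _ DF) linearZ.
Qed.

Section TimeChange.
Context {R : realType} {V : normedModType R}.
Variables (J : set R) (tau d : R -> R).
Hypotheses (oJ : open J) (iJ : is_interval J).
Hypothesis tauD : forall t, J t -> is_derive t 1 tau (d t).
Hypothesis d0 : forall t, J t -> d t != 0.

(** A repeated value of [tau] would, by Rolle, give a zero of [d] strictly between; the point lies
    in [J] because [J] is an interval. *)
Lemma time_change_inj t1 t2 : J t1 -> J t2 -> tau t1 = tau t2 -> t1 = t2.
Proof.
wlog t12 : t1 t2 / t1 < t2.
  move=> wl; case: (ltgtP t1 t2) => // t12 J1 J2 tau12; first exact: wl.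
  by apply/esym/wl.
move=> J1 J2 tau12.
have J12 c : t1 <= c <= t2 -> J c by move=> c12; exact: iJ c12.
have [||c] := Rolle t12 _ _ tau12.
- move=> c; rewrite in_itv/= => /andP[c1 c2].
  by apply: ex_derive; apply: tauD; apply: J12; rewrite !ltW.
- apply: derivable_within_continuous => c; rewrite in_itv/= => c12.
  by apply: ex_derive; apply: tauD; apply: J12.
- rewrite in_itv/= => /andP[c1 c2] Dc.
  have Jc : J c by apply: J12; rewrite !ltW.
  have /eqP[] := d0 Jc.
  by have /@derive_val <- := tauD Jc; exact: derive_val.
Qed.

(** Nothing is assumed about the regularity of [q]: near [tau t] it coincides with [u] composed with
    a local inverse of [tau], and the derivative follows from the inverse function rule. *)
Lemma time_change_is_derive (u q : R -> V) (t : R) (du : V) :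
  (forall t, J t -> q (tau t) = u t) -> J t ->
  is_derive t 1 u du -> is_derive (tau t) 1 q ((d t)^-1 *: du).
Proof.
move=> qu Jt Du.
(* A chosen preimage in [J], unique by injectivity; the default value 0 is taken only off the image
   of [J]. *)
pose g s := xget 0 [set r | J r /\ tau r = s].
have gK r : J r -> g (tau r) = r.
  move=> Jr; rewrite /g; case: xgetP => [r' _ [Jr' rr']|/(_ r)[]//].
  exact: time_change_inj.
have nJ : \forall r \near t, J r by exact: open_nbhs_nbhs.
have ngK : {near t, cancel tau g} by near=> r; apply: gK; near: r.
have ctau : {near t, continuous tau}.
  near=> r; apply: differentiable_continuous; apply/derivable1_diffP.
  by apply: ex_derive; apply: tauD; near: r.
have Dg : is_derive (tau t) 1 g (d t)^-1.
  by apply: is_derive_inverse => //; [exact: tauD|exact: d0].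
(* By continuity and local injectivity, the image of [tau] fills a neighbourhood of [tau t]. *)
have ntauK : {near tau t, cancel g tau} by exact: near_continuous_can_sym.
have cg : g s @[s --> tau t] --> t.
  rewrite -[X in _ --> X](gK _ Jt); apply: differentiable_continuous.
  by apply/derivable1_diffP; exact: ex_derive.
have ngJ : \forall s \near tau t, J (g s) by exact: cg.
have : is_derive (tau t) 1 (fun s => u (g s)) ((d t)^-1 *: du).
  by apply: is_derive_comp; rewrite gK.
apply: near_eq_is_derive; near=> s.
rewrite -qu; last by near: s.
by congr q; near: s.
Unshelve. all: by end_near. Qed.

End TimeChange.

(** * The change of momenta and the transport of motions *)

Section Reduction.
Context {R : realType} {n : nat}.
Variables (A : 'M[R]_n) (eps : R).
Hypothesis symA : A^T = A.
Hypothesis posA : forall v : 'cV[R]_n, v != 0 -> 0 < dot (A *m v) v.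
Hypothesis unitA : A \in unitmx.
Hypothesis eps0 : eps != 0.
Implicit Types (p v gamma : 'cV[R]_n) (z w X Y : 'cV[R]_n * 'cV[R]_n).

Let symB : (invmx A)^T = invmx A.
Proof. by rewrite trmx_inv symA. Qed.

Lemma nu_neq0 gamma : 0 < dot (A *m gamma) gamma -> nu A eps gamma != 0.
Proof. by move=> al0; rewrite mulf_neq0// gt_eqF// powR_gt0. Qed.

Definition diff_nu gamma v : R :=
  2 * eps * (1 / (2 * eps) - 1) *
  dot (A *m gamma) gamma `^ (1 / (2 * eps) - 2) * dot (A *m gamma) v.

Lemma is_diff_nu z : 0 < dot (A *m z.2) z.2 ->
  is_diff z (fun y => nu A eps y.2) (fun h => diff_nu z.2 h.2).
Proof.
move=> al0.
have D2 : is_diff z (fun y : 'cV[R]_n * 'cV[R]_n => y.2) (fun h => h.2).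
  by apply: is_diff_snd; exact: is_diff_id.
have Dal := is_diff_dot (is_diff_mulmx A D2) D2.
have D := is_diff_scalec eps (is_diff_powR (x := z)
  (f := fun y => dot (A *m y.2) y.2) (1 / (2 * eps) - 1) al0 Dal).
apply: (is_diff_eq D); apply/funext => h /=.
rewrite (dot_sym_mx h.2 _ symA) (dotC h.2) /diff_nu.
have -> : 1 / (2 * eps) - 1 - 1 = 1 / (2 * eps) - 2 by ring.
set e := 1 / (2 * eps) - 1; rewrite /GRing.scale /=; ring.
Qed.

Lemma is_diff_new_momenta z : 0 < dot (A *m z.2) z.2 ->
  is_diff z (new_momenta A eps)
    (fun Y => (nu A eps z.2 *: Y.1 + diff_nu z.2 Y.2 *: z.1, Y.2)).
Proof.
move=> al0.
have D1 : is_diff z (fun y : 'cV[R]_n * 'cV[R]_n => y.1) (fun h => h.1).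
  by apply: is_diff_fst; exact: is_diff_id.
have D2 : is_diff z (fun y : 'cV[R]_n * 'cV[R]_n => y.2) (fun h => h.2).
  by apply: is_diff_snd; exact: is_diff_id.
exact: is_diff_pair (is_diff_scale (is_diff_nu al0) D1) D2.
Qed.

(** Inverse of the change of momenta wherever [nu] is nonzero; it serves to carry motions of the
    geodesic flow back. *)
Definition old_momenta w := ((nu A eps w.2)^-1 *: w.1, w.2).

Lemma new_momentaK z :
  0 < dot (A *m z.2) z.2 -> old_momenta (new_momenta A eps z) = z.
Proof.
move=> /nu_neq0 nu0; rewrite /old_momenta /= scalerA mulVf// scale1r.
by case: z {nu0}.
Qed.

Lemma is_diff_old_momenta w : 0 < dot (A *m w.2) w.2 ->
  is_diff w old_momenta (fun Y =>
    ((nu A eps w.2)^-1 *: Y.1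
     - ((nu A eps w.2)^-1 ^+ 2 * diff_nu w.2 Y.2) *: w.1, Y.2)).
Proof.
move=> al0; have Dnu := is_diff_nu al0; have nu0 := nu_neq0 al0.
have DV : is_diff w (fun y => (nu A eps y.2)^-1)
    (fun h => - ((nu A eps w.2)^-1 ^+ 2 * diff_nu w.2 h.2)).
  apply: DiffDef; first exact: (@differentiableV _ _ (fun y => nu A eps y.2)).
  rewrite (@diffV _ _ (fun y => nu A eps y.2))// diff_val.
  by apply/funext => h /=; rewrite /GRing.scale /= mulNr exprVn.
have D1 : is_diff w (fun y : 'cV[R]_n * 'cV[R]_n => y.1) (fun h => h.1).
  by apply: is_diff_fst; exact: is_diff_id.
have D2 : is_diff w (fun y : 'cV[R]_n * 'cV[R]_n => y.2) (fun h => h.2).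
  by apply: is_diff_snd; exact: is_diff_id.
apply: (is_diff_eq (is_diff_pair (is_diff_scale DV D1) D2)).
by apply/funext => h; rewrite scaleNr.
Qed.

Definition reduced_field z :=
  (reduced_p_dot A eps z.1 z.2, reduced_gamma_dot A eps z.1 z.2).

(** The left side is the differential of [new_momenta] applied to the reduced field. All real powers
    are expressed through [al] and one power [P], after which the identity is rational in each
    coordinate. *)
Lemma diff_new_momenta_reduced_field z : cotangent_sphere z ->
  (nu A eps z.2 *: (reduced_field z).1
   + diff_nu z.2 (reduced_field z).2 *: z.1, (reduced_field z).2) =
  nu A eps z.2 *: geodesic_field A eps (new_momenta A eps z).
Proof.
case: z => p g [/= gg gp]; have al0 := sphere_gt0 posA gg.
have gBp : dot g (invmx A *m p) = dot p (invmx A *m g).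
  by rewrite -(dot_sym_mx _ _ symB) dotC.
(* Hence only the component of the velocity along [g] contributes to the derivative of [nu]. *)
have AgBp : dot (A *m g) (invmx A *m p) = 0.
  by rewrite (dot_sym_mx _ _ symA) mulmxA mulmxV// mul1mx.
rewrite /diff_nu /geodesic_field /= /reduced_p_dot /reduced_gamma_dot /nu.
rewrite (dotC g (A *m g)) (dotC p (invmx A *m p)) -!scalemxAr.
rewrite [dot (A *m g) (_ *: _)]dotZr dotDr dotNr dotZr AgBp sub0r.
rewrite !dotZl !dotZr.
set al := dot (A *m g) g in al0 *; set be := dot p _; set h := dot (invmx A *m p) p.
(* [nu] is [eps * P], and [al * P ^+ 2] is [al] to the power [1 / eps - 1], the inverse of the
   conformal factor of the Hamiltonian. *)
set P := al `^ (1 / (2 * eps) - 1).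
have P0 : 0 < P by exact: powR_gt0.
have PE : al `^ (1 / (2 * eps) - 2) = P / al.
  rewrite -(powR_inv1 (ltW al0)) -gt0_powRD//; congr (_ `^ _); ring.
have kE : al `^ (1 - 1 / eps) = (al * P ^+ 2)^-1.
  rewrite -{2}(powRr1 (ltW al0)) expr2 -!gt0_powRD// -powRN; congr (_ `^ _).
  by field.
have k1E : al `^ (- (1 / eps)) = (al ^+ 2 * P ^+ 2)^-1.
  have -> : - (1 / eps) = (1 - 1 / eps) - 1 by ring.
  rewrite gt0_powRD// kE powR_inv1 ?ltW//; field.
  by rewrite !gt_eqF.
rewrite PE kE k1E.
have al0' : al != 0 by rewrite gt_eqF.
have P0' : P != 0 by rewrite gt_eqF.
move: al be h P {PE kE k1E} al0' P0' {al0 P0 gBp AgBp}.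
move: (A *m g) (invmx A *m p) => Ag Bp al be h P al0 P0.
by congr pair; apply/colP => i; rewrite !mxE; field; rewrite ?al0 ?P0 ?eps0.
Qed.

Lemma hamiltonian_motion_geodesicP (K : set R) q :
  hamiltonian_motion (geodesic_ham A eps) K q <->
  forall s, K s -> cotangent_sphere (q s) /\
    is_derive s 1 q (geodesic_field A eps (q s)).
Proof.
split=> H s /H[cq].
  by move=> [X [Dq /(hamiltonian_vector_geodesicP eps symA posA _ cq) XE]]; rewrite -XE.
move=> Dq; split=> //; exists (geodesic_field A eps (q s)); split=> //.
exact/hamiltonian_vector_geodesicP.
Qed.

Lemma cotangent_sphere_new_momenta z :
  cotangent_sphere (new_momenta A eps z) <-> cotangent_sphere z.
Proof.
case: z => p g; rewrite /cotangent_sphere /= dotZr; split=> -[gg].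
  move=> /eqP; rewrite mulf_eq0 (negbTE (nu_neq0 (sphere_gt0 posA gg))) /=.
  by move=> /eqP.
by move=> ->; rewrite mulr0.
Qed.

(** Forward, the derivative of [new_momenta] along [z] is divided by the rate of [tau]. Backward,
    [z] equals [old_momenta] of [q] composed with [tau] on the open set [J], so the chain rule
    applies without inverting [tau]. *)
Lemma reduced_motion_geodesic_flow (J : set R)
    (z q : R -> 'cV[R]_n * 'cV[R]_n) (tau : R -> R) :
  open J -> is_interval J ->
  (forall t, J t -> is_derive t 1 tau (nu A eps (z t).2)) ->
  (forall t, J t -> q (tau t) = new_momenta A eps (z t)) ->
  reduced_motion A eps J z <->
  hamiltonian_motion (geodesic_ham A eps) (tau @` J) q.
Proof.
move=> oJ iJ tauD qz.
apply: (iff_trans _ (iff_sym (hamiltonian_motion_geodesicP _ _))).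
split=> [H s [t Jt <-]|H t Jt].
- have [cz Dz] := H t Jt; have al0 := sphere_gt0 posA cz.1.
  rewrite qz//; split; first exact/cotangent_sphere_new_momenta.
  have nu0 r : J r -> nu A eps (z r).2 != 0.
    by move=> /H[[gg _] _]; apply: nu_neq0; exact: sphere_gt0.
  have D := is_derive_diff_comp Dz (is_diff_new_momenta al0).
  have := time_change_is_derive oJ iJ tauD nu0 qz Jt D.
  by rewrite (diff_new_momenta_reduced_field cz) scalerA mulVf ?nu0// scale1r.
- have cz r : J r -> cotangent_sphere (z r).
    move=> Jr; apply/cotangent_sphere_new_momenta; rewrite -qz//.
    by have [] := H _ (imageP tau Jr).
  have zq r : J r -> z r = old_momenta (q (tau r)).
    by move=> Jr; rewrite qz// new_momentaK//; apply: sphere_gt0 (cz _ Jr).1.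
  split; first exact: cz.
  have al0 := sphere_gt0 posA (cz _ Jt).1; have nu0 := nu_neq0 al0.
  have [_ Dq] := H _ (imageP tau Jt).
  have Dqt := is_derive_comp (tauD _ Jt) Dq.
  rewrite qz// -(diff_new_momenta_reduced_field (cz _ Jt)) in Dqt.
  have al0' : 0 < dot (A *m (q (tau t)).2) (q (tau t)).2 by rewrite qz.
  have := is_derive_diff_comp Dqt (is_diff_old_momenta al0').
  rewrite qz//= scalerDr !scalerA mulVf// scale1r.
  (* With this, the [diff_nu] term from the differential of [old_momenta] cancels the one from
     [new_momenta], leaving the reduced field. *)
  have cancel_sq (c d : R) : c != 0 -> c^-1 ^+ 2 * d * c = c^-1 * d.
    by move=> ?; field.
  rewrite cancel_sq// addrK; apply: near_eq_is_derive.
  have : \forall r \near t, J r by exact: open_nbhs_nbhs.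
  by apply: filterS => r Jr; rewrite zq.
Qed.

End Reduction.

(** * The rubber Chaplygin ball with diagonal [A] *)

Theorem theorem12 (R : realType) (n : nat) (a : 'rV[R]_n)
    (m rho sigma : R) (inner : bool)
    (inertia : {linear 'M[R]_n -> 'M[R]_n})
    (ha : forall i, 0 < a 0 i)
    (hm : 0 < m) (hrho : 0 < rho) (hsigma : 0 < sigma)
    (hinner : inner -> sigma <> rho)
    (hinertia : forall i j : 'I_n,
       inertia (wedge (basis_vec i) (basis_vec j)) =
       (a 0 i * a 0 j - m * rho ^+ 2) *: wedge (basis_vec i) (basis_vec j)) :
  let A := diag_mx a in
  let eps := radii_ratio inner sigma rho in
  (forall gamma v : 'cV[R]_n, sphere gamma -> tangent_sphere gamma v ->
     v != 0 -> 0 < ds2 A eps gamma v) /\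
  exists H : 'cV[R]_n * 'cV[R]_n -> R,
    [/\ forall z, cotangent_sphere z -> differentiable H z,
        legendre_transform (fun v gamma => 2^-1 * ds2 A eps gamma v) H
      & forall (J : set R) (z q : R -> 'cV[R]_n * 'cV[R]_n) (tau : R -> R),
          open J -> is_interval J ->
          (forall t, J t -> is_derive t 1 tau (nu A eps (z t).2)) ->
          (forall t, J t -> q (tau t) = new_momenta A eps (z t)) ->
          (reduced_motion A eps J z <-> hamiltonian_motion H (tau @` J) q)].
Proof.
move=> A eps.
have symA : A^T = A by exact: tr_diag_mx.
have posA (v : 'cV[R]_n) : v != 0 -> 0 < dot (A *m v) v.
  move=> v0; rewrite dotE; under eq_bigr do rewrite mul_diag_mx mxE -mulrA.
  have [i vi0] : exists i, v i 0 != 0.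
    by apply/existsP; apply: contraNT v0 => /existsPn v0; apply/eqP/colP => i;
      rewrite mxE; exact/eqP/negPn/v0.
  rewrite (bigD1 i)//= ltr_pwDl//.
    by rewrite mulr_gt0// -expr2 exprn_even_gt0.
  by apply: sumr_ge0 => j _; rewrite mulr_ge0 -?expr2 ?sqr_ge0 ?ltW//.
have unitA : A \in unitmx.
  rewrite unitmxE det_diag unitfE; apply/prodf_neq0 => i _.
  by rewrite gt_eqF.
have eps0 : eps != 0.
  (* For the inner sign [hinner] keeps the denominator nonzero; division by zero would return 0 and
     make [eps] vanish. *)
  rewrite /eps /radii_ratio; case: ifPn => [/hinner/eqP sr|_].
    by rewrite mulf_neq0 ?invr_eq0 ?subr_eq0// gt_eqF.
  by rewrite mulf_neq0 ?invr_eq0 ?gt_eqF// addr_gt0.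
split; first exact: ds2_gt0.
exists (geodesic_ham A eps); split.
- move=> z [gg _].
  have D := is_diff_geodesic_ham eps symA (sphere_gt0 posA gg).
  exact: ex_diff.
- exact: legendre_geodesic_ham.
- by move=> J z q tau; exact: reduced_motion_geodesic_flow.
Qed.
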